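(* Let $k,n,p\ge1$ and let $\mathcal{X}$ be an $n\times p$ indeterminate complex tubal vector. There is a bijection between order $2k+1$ $t$-conjugate partially symmetric hypermatrices $\mathcal{A}\in\mathbb{C}^{n\times\dots\times n\times p}$ and degree $k$ $t$-Hermitian forms in $\mathcal{X}$, and in particular it is given by the map $$\mathcal{A}\mapsto h_{\mathcal{A}}(\mathcal{X}):=\mathcal{A}*_t\big(\underbrace{J(\mathcal{X}),\dots,J(\mathcal{X})}_{k},\underbrace{\mathcal{X},\dots,\mathcal{X}}_{k}\big).$$
   Context: Notation: $[m]=\{1,\dots,m\}$. For a tube $a$ of length $p$, $\widehat a=\mathrm{fft}(a)$ is $\widehat a[\ell]=\sum_{m=1}^p e^{-2\pi i(\ell-1)(m-1)/p}a[m]$; for arrays whose last mode (tubal mode) has length $p$, the hat means applying $\mathrm{fft}$ along that mode, and $(\ell)$ means fixing the last index to $\ell$. Circular convolution: $(a\circledast b)[\ell]=\sum_{m=1}^p a[m]\,b[((\ell-m)\bmod p)+1]$. Fourier conjugation of a tube: $J(a)[\ell+1]=\overline{a[((-\ell)\bmod p)+1]}$, $\ell=0,\dots,p-1$; it acts tube by tube on tubal vectors. An $n\times p$ indeterminate complex tubal vector $\mathcal{X}$ is one for which $\widehat{\mathcal{X}}_{(\ell)}=x^\ell=[x_1^\ell,\dots,x_n^\ell]^T$ is a vector of complex variables for each $\ell\in[p]$ (so the entries of $\mathcal{X}$ are linear combinations of the $np$ independent complex variables $x_i^\ell$, and conjugation sends a variable to its formal conjugate). $t$-multilinear hypermatrix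 product: $\mathcal{A}*_t(\mathcal{X}^1,\dots,\mathcal{X}^N)=\sum_{i_1,\dots,i_N=1}^n\mathcal{A}[i_1,\dots,i_N,:]\circledast\mathcal{X}^1[i_1,:]\circledast\cdots\circledast\mathcal{X}^N[i_N,:]$, a tube of length $p$ whose entries are polynomials in the variables and their formal conjugates. An order $2k$ hypermatrix $\mathcal{B}=[b_{i_1\dots i_kj_1\dots j_k}]\in\mathbb{C}^{n\times\dots\times n}$ is conjugate partially symmetric if $\overline{b_{j_{\sigma(1)}\dots j_{\sigma(k)}i_{\tau(1)}\dots i_{\tau(k)}}}=b_{i_1\dots i_kj_1\dots j_k}$ for all indices and all $\sigma,\tau\in S_k$. An order $2k+1$ hypermatrix $\mathcal{A}\in\mathbb{C}^{n\times\dots\times n\times p}$ is $t$-conjugate partially symmetric if each $\widehat{\mathcal{A}}_{(\ell)}$, $\ell\in[p]$, is conjugate partially symmetric. A degree $k$ $t$-Hermitian form in $\mathcal{X}$ is an expression of the form $\mathcal{A}*_t(J(\mathcal{X}),\dots,J(\mathcal{X}),\mathcal{X},\dots,\mathcal{X})$ ($k$ copies of each) for some order $2k+1$ $t$-conjugate partially symmetric hypermatrix $\mathcal{A}$. *)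

(* Defs.v *)
From mathcomp Require Import all_boot all_order all_algebra all_fingroup.
From mathcomp Require Import boolp classical_sets functions reals trigo.
From mathcomp Require Import complex ring.
From mathcomp Require Import -(notations) mpoly.

Set Implicit Arguments.
Unset Strict Implicit.
Unset Printing Implicit Defensive.

Import Order.TTheory GRing.Theory Num.Theory.

Local Open Scope ring_scope.

(* All tube indices are 0-based: the entries of a tube of length p are indexed
   by 'I_p = {0, ..., p - 1}, so the 1-based index l is ordinal l - 1. *)

Section Tubes.

Variable p : nat.

Lemma ord_gt0 (i : 'I_p) : (0 < p)%N.
Proof. exact: leq_ltn_trans (leq0n i) (ltn_ord i). Qed.

Definition modsub (l m : 'I_p) : 'I_p :=
  Ordinal (ltn_pmod (l + (p - m)) (ord_gt0 l)).

Definition modopp (l : 'I_p) : 'I_p :=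
  Ordinal (ltn_pmod (p - l) (ord_gt0 l)).

Definition circonv (T : pzSemiRingType) (a b : 'rV[T]_p) : 'rV[T]_p :=
  \row_l \sum_(m < p) a 0 m * b 0 (modsub l m).

End Tubes.

Section Fourier.

Variable R : realType.

(* e^(i t) for a real t. *)
Definition expi (t : R) : R[i] := Complex (cos t) (sin t).

(* The last (column) mode is the tubal mode: row i of the matrix is a tube.
   The entries live in an arbitrary C-module, so that the transform applies to
   tubes of complex numbers as well as to tubes of polynomials. *)
Definition fft (V : lmodType R[i]) (m p : nat) (a : 'M[V]_(m, p)) :
    'M[V]_(m, p) :=
  \matrix_(i, l) \sum_(s < p)
    expi (- (2 * pi * l%:R * s%:R / p%:R)) *: a i s.

End Fourier.

(* (i, l, false) is the variable x_i^l; (i, l, true) is its formal conjugate. *)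
Notation tvars n p := ('I_n * 'I_p * bool)%type.

Notation tpoly R n p := (mpoly #|{: tvars n p}| R[i]).

Section Forms.

Variables (R : realType) (n p : nat).

Definition tvar (v : tvars n p) : tpoly R n p :=
  mpolyX R[i] (mnm1 (enum_rank v)).

Definition conj_var (v : tvars n p) : tvars n p :=
  let: (i, l, b) := v in (i, l, ~~ b).

(* Conjugates the coefficients and exchanges each variable with its formal
   conjugate. *)
Definition fconj (f : tpoly R n p) : tpoly R n p :=
  mmap (fun c : R[i] => mpolyC #|{: tvars n p}| (c^* : R[i]))
       (fun j : 'I_#|{: tvars n p}| => tvar (conj_var (enum_val j))) f.

Definition tvec := 'M[tpoly R n p]_(n, p).

Definition J (X : tvec) : tvec := \matrix_(i, l) fconj (X i (modopp l)).

Definition indeterminate (X : tvec) : Prop :=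
  forall (i : 'I_n) (l : 'I_p), fft X i l = tvar (i, l, false).

(* An order N hypermatrix in C^(n x ... x n). *)
Definition hypermx (N : nat) := {ffun N.-tuple 'I_n -> R[i]}.

(* An order N + 1 hypermatrix in C^(n x ... x n x p), as the family of its
   tubes. *)
Definition thypermx (N : nat) := {ffun N.-tuple 'I_n -> 'rV[R[i]]_p}.

Definition fft_slice (N : nat) (A : thypermx N) (l : 'I_p) : hypermx N :=
  [ffun i => fft (A i : 'rV[R[i]^o]_p) 0 l].

Definition tmulti (N : nat) (A : thypermx N) (Xs : N.-tuple tvec) :
    'rV[tpoly R n p]_p :=
  \sum_(i : N.-tuple 'I_n)
    foldl (@circonv p (tpoly R n p))
      (map_mx (@mpolyC #|{: tvars n p}| R[i]) (A i))
      [seq row (tnth i j) (tnth Xs j) | j <- enum 'I_N].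

Definition perm_index (k : nat) (s : 'S_k) (i : k.-tuple 'I_n) :
    k.-tuple 'I_n :=
  [tuple tnth i (s m) | m < k].

Definition conj_partially_sym (k : nat) (B : hypermx (k + k)) : Prop :=
  forall (i j : k.-tuple 'I_n) (s t : 'S_k),
    (B [tuple of perm_index s j ++ perm_index t i])^* = B [tuple of i ++ j].

Definition t_conj_partially_sym (k : nat) (A : thypermx (k + k)) : Prop :=
  forall l : 'I_p, conj_partially_sym (fft_slice A l).

Definition t_form (k : nat) (X : tvec) (A : thypermx (k + k)) :
    'rV[tpoly R n p]_p :=
  tmulti A [tuple of nseq k (J X) ++ nseq k X].

Definition t_Hermitian_form (k : nat) (X : tvec) (h : 'rV[tpoly R n p]_p) :
    Prop :=
  exists2 A : thypermx (k + k), t_conj_partially_sym A & h = t_form X A.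

End Forms.

Lemma expiD (R : realType) (a b : R) : expi (a + b) = expi a * expi b.
Proof. by rewrite /expi cosD sinD; apply/eqP; rewrite eq_complex /= eqxx addrC eqxx. Qed.
Lemma expi0 (R : realType) : expi (0 : R) = 1.
Proof. by rewrite /expi cos0 sin0. Qed.
Lemma expiMn (R : realType) (a : R) m : expi (a *+ m) = expi a ^+ m.
Proof. by elim: m => [|m IH]; rewrite ?mulr0n ?expi0 // mulrS expiD IH exprS. Qed.
Lemma expi2pi (R : realType) : expi (2 * pi : R) = 1.
Proof. by rewrite /expi mulr_natl cos2pi sin2pi. Qed.

Lemma expi_neq1 (R : realType) (a : R) : 0 < a < 2 * pi -> expi a != 1.
Proof.
move=> /andP[a0 a2]; rewrite eq_complex /= negb_and; apply/orP; left.
have -> : a = (a / 2) *+ 2 by rewrite -mulr_natr mulfVK ?pnatr_eq0.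
set b := a / 2.
have -> : cos (b *+ 2) = 1 - sin b ^+ 2 *+ 2.
  by rewrite mulr2n cosD -!expr2 cos2sin2 mulr2n opprD addrA.
rewrite -subr_eq0 addrAC subrr add0r oppr_eq0 mulrn_eq0 /= expf_neq0 //.
by rewrite gt_eqF// sin_gt0_pi// divr_gt0//= ltr_pdivrMr// mulrC.
Qed.

Lemma dft_orth (R : realType) p (l t : 'I_p) :
  \sum_(s < p) expi (- (2 * pi * l%:R * s%:R / p%:R) : R)
     * expi (2 * pi * t%:R * s%:R / p%:R) = (l == t)%:R * p%:R.
Proof.
have p0 : p%:R != 0 :> R by rewrite pnatr_eq0 -lt0n (leq_ltn_trans _ (ltn_ord l)).
have pp : (0 < p%:R :> R) by rewrite lt_def p0 ler0n.
pose z : R[i] := expi (2 * pi * (t%:R - l%:R) / p%:R).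
have E (s : 'I_p) : expi (- (2 * pi * l%:R * s%:R / p%:R) : R)
     * expi (2 * pi * t%:R * s%:R / p%:R) = z ^+ s.
  by rewrite -expiD -expiMn; congr expi; rewrite -[RHS]mulr_natr; field.
under eq_bigr => s _ do rewrite E.
case: eqVneq => [lt|lt].
  rewrite mul1r /z lt subrr mulr0 mul0r expi0.
  by under eq_bigr do rewrite expr1n; rewrite sumr_const card_ord.
have zp : z ^+ p = 1.
  rewrite /z -expiMn -[X in expi X]mulr_natr mulfVK // mulrBr expiD.
  have a1 (m : nat) : expi (2 * pi * m%:R : R) = 1.
    by rewrite mulr_natr expiMn expi2pi expr1n.
  rewrite a1 mul1r.
  have : expi (2 * pi * l%:R : R) * expi (- (2 * pi * l%:R)) = 1.
    by rewrite -expiD subrr expi0.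
  by rewrite a1 mul1r.
have P0 := pi_gt0 R.
have z1 : z != 1.
  have key (a b : nat) : (a < b < p)%N ->
      expi (2 * pi * (b%:R - a%:R) / p%:R : R) != 1.
    move=> /andP[ab bp]; apply: expi_neq1; apply/andP; split.
      by rewrite divr_gt0// !mulr_gt0 // subr_gt0 ltr_nat.
    rewrite ltr_pdivrMr// ltr_pM2l ?mulr_gt0 //.
    rewrite ltrBlDr (@lt_le_trans _ _ p%:R) ?ltr_nat //.
    by rewrite lerDl ler0n.
  case: (ltngtP l t) => h; last by move: lt; rewrite -val_eqE /= h eqxx.
    by apply: key; rewrite h /=.
  apply/eqP => z1; have := key t l; rewrite h ltn_ord => /(_ isT) /eqP; apply.
  have : z * expi (2 * pi * (l%:R - t%:R) / p%:R) = 1.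
    by rewrite /z -expiD -[RHS](expi0 R); congr expi; field.
  by rewrite z1 mul1r.
rewrite mul0r; apply: (mulfI (x := z - 1)); first by rewrite subr_eq0.
by rewrite mulr0 -subrX1 zp subrr.
Qed.

(* The variables x_i^l determine an indeterminate vector by inverse Fourier
   transform, so the predicate is inhabited for all n and p. *)
Lemma indeterminate_exists (R : realType) (n p : nat) :
  exists X : tvec R n p, indeterminate X.
Proof.
exists (\matrix_(i, s) \sum_(t < p)
   ((p%:R)^-1 * expi (2 * pi * t%:R * s%:R / p%:R)) *: tvar R (i, t, false)).
move=> i l; rewrite mxE.
under eq_bigr => s _ do rewrite mxE scaler_sumr.
rewrite exchange_big /=.
under eq_bigr => t _.
  under eq_bigr => s _ do rewrite scalerA mulrCA -scalerA.
  rewrite -scaler_sumr -scaler_suml dft_orth.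
  over.
have p0 : p%:R != 0 :> R[i] by rewrite pnatr_eq0 -lt0n (leq_ltn_trans _ (ltn_ord l)).
rewrite (bigD1 l) //= eqxx mul1r scalerA mulVf // scale1r big1 ?addr0 // => t tl.
by rewrite eq_sym (negbTE tl) mul0r scale0r scaler0.
Qed.

Arguments t_form {R n p} k X A.

(* Main.v *)
(** Along the tubal mode the discrete Fourier transform turns circular
    convolution into the entrywise product and [J] into formal conjugation, so
    that slice [l] of the transform of a [t]-Hermitian form is the ordinary
    Hermitian form [\sum_(i, j) b_ij conj(x_i1) .. conj(x_ik) x_j1 .. x_jk] of
    slice [l] of the transform of [A], in independent variables.  Two index
    pairs [(i, j)] and [(i', j')] give the same monomial exactly when [i'] is a
    rearrangement of [i] and [j'] of [j]; a conjugate partially symmetric [b] is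
    constant on such a class, so the coefficient of the monomial is a positive
    integer multiple of [b_ij].  The form thus determines each transformed
    slice, and the transform is injective. *)

Require Import Defs.
From mathcomp Require Import all_boot all_order all_algebra all_fingroup.
From mathcomp Require Import boolp classical_sets functions reals trigo.
From mathcomp Require Import complex ring.
From mathcomp Require Import -(notations) mpoly.

Import Order.TTheory GRing.Theory Num.Theory.

(** * The discrete Fourier transform along the tubal mode *)

Section FourierTransform.
Local Open Scope ring_scope.
Variables (R : realType) (p : nat).

(** A [p]-th root of unity whose powers are the weights of [fft], so exponents may be reduced modulo
    [p]. *)
Definition twiddle (l : 'I_p) : R[i] := expi (- (2 * pi * l%:R / p%:R)).

Lemma expi_twiddle (l s : 'I_p) :
  expi (- (2 * pi * l%:R * s%:R / p%:R)) = twiddle l ^+ s.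
Proof. by rewrite -expiMn -[X in _ = expi X]mulr_natr; congr expi; ring. Qed.

Lemma fftE (V : lmodType R[i]) m (a : 'M[V]_(m, p)) i l :
  fft a i l = \sum_(s < p) twiddle l ^+ s *: a i s.
Proof. by rewrite mxE; apply: eq_bigr => s _; rewrite expi_twiddle. Qed.

Lemma expi_conj (t : R) : (expi t)^* = expi (- t).
Proof. by rewrite /expi cosN sinN. Qed.

Lemma twiddle_conj (l : 'I_p) : (twiddle l)^* * twiddle l = 1.
Proof. by rewrite expi_conj -expiD addNr expi0. Qed.

Lemma twiddle_unity (l : 'I_p) : twiddle l ^+ p = 1.
Proof.
have p0 : p%:R != 0 :> R by rewrite pnatr_eq0 -lt0n (ord_gt0 l).
have h : expi (2 * pi * l%:R : R) = 1.
  by rewrite mulr_natr expiMn expi2pi expr1n.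
rewrite -expiMn -[X in expi X]mulr_natr mulNr mulfVK //.
by rewrite -expi_conj h rmorph1.
Qed.

(** [twiddle l] has modulus one, so conjugating a power inverts it, which amounts to negating the
    exponent modulo [p]. *)
Lemma twiddle_modopp (l s : 'I_p) : twiddle l ^+ modopp s = (twiddle l ^+ s)^*.
Proof.
rewrite /= expr_mod ?twiddle_unity // rmorphXn /=.
rewrite -[LHS]mul1r -(expr1n _ s) -(twiddle_conj l) exprMn -mulrA -exprD.
by rewrite subnKC ?twiddle_unity ?mulr1 // ltnW.
Qed.

Lemma modoppK : involutive (@modopp p).
Proof.
move=> s; apply: val_inj => /=.
(* Index [0] is a fixed point and needs its own case: [p - 0] is [p], which reduces to [0]. *)
have [s0|s0] := posnP s; first by rewrite s0 subn0 modnn subn0 modnn.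
rewrite (@modn_small (p - s)) ?ltn_subrL ?s0 ?(ord_gt0 s) //.
by rewrite subKn ?modn_small // ltnW.
Qed.

Lemma modsub_inj (m : 'I_p) : injective (@modsub p ^~ m).
Proof.
move=> s t /(congr1 val) /= /eqP; rewrite eqn_modDr !modn_small //.
by move/eqP/val_inj.
Qed.

Lemma twiddle_modsub (l m s : 'I_p) :
  twiddle l ^+ m * twiddle l ^+ modsub s m = twiddle l ^+ s.
Proof.
rewrite /= expr_mod ?twiddle_unity // -exprD addnCA subnKC ?exprD.
  by rewrite twiddle_unity mulr1.
exact: ltnW.
Qed.

(** For fixed [m] the shift by [m] permutes the indices, and the weight at [s] factors into the
    weights at [m] and at [s - m]. *)
Lemma fft_circonv (V : algType R[i]) (a b : 'rV[V]_p) l :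
  fft (circonv a b) 0 l = fft a 0 l * fft b 0 l.
Proof.
rewrite !fftE mulr_suml.
under eq_bigr do rewrite mxE scaler_sumr.
rewrite exchange_big; apply: eq_bigr => m _ /=.
rewrite mulr_sumr [RHS](reindex_inj (modsub_inj m)); apply: eq_bigr => s _.
by rewrite -scalerAl -scalerAr scalerA twiddle_modsub.
Qed.

Lemma fft_foldl_circonv (V : algType R[i]) (a : 'rV[V]_p)
    (bs : seq 'rV[V]_p) l :
  fft (foldl (@circonv p V) a bs) 0 l = fft a 0 l * \prod_(b <- bs) fft b 0 l.
Proof.
elim: bs a => [|b bs IH] a; first by rewrite big_nil mulr1.
by rewrite /= IH big_cons fft_circonv mulrA.
Qed.

Lemma fft_sum (V : lmodType R[i]) (I : finType) (a : I -> 'rV[V]_p) l :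
  fft (\sum_i a i) 0 l = \sum_i fft (a i) 0 l.
Proof.
rewrite fftE.
under eq_bigr do rewrite summxE scaler_sumr.
by rewrite exchange_big; apply: eq_bigr => i _; rewrite fftE.
Qed.

Lemma fft_row (V : lmodType R[i]) m (a : 'M[V]_(m, p)) i l :
  fft (row i a) 0 l = fft a i l.
Proof. by rewrite !fftE; apply: eq_bigr => s _; rewrite mxE. Qed.

(** Fourier inversion, scaled by [p] to avoid a division: orthogonality of the characters leaves
    only the term [s = t]. *)
Lemma fftK (V : lmodType R[i]) m (a : 'M[V]_(m, p)) i (t : 'I_p) :
  \sum_(l < p) expi (2 * pi * t%:R * l%:R / p%:R) *: fft a i l = p%:R *: a i t.
Proof.
under eq_bigr do rewrite mxE scaler_sumr.
rewrite exchange_big /= (bigD1 t) //= [X in _ + X]big1 ?addr0 => [|s st].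
  under eq_bigr => l _ do rewrite scalerA mulrC (mulrAC _ l%:R t%:R).
  by rewrite -scaler_suml dft_orth eqxx mul1r.
under eq_bigr => l _ do rewrite scalerA mulrC (mulrAC _ l%:R s%:R).
by rewrite -scaler_suml dft_orth (negbTE st) mul0r scale0r.
Qed.

Lemma fft_inj (V : lmodType R[i]) m : injective (@fft R V m p).
Proof.
move=> a b eq_ab; apply/matrixP => i t.
have p0 : p%:R != 0 :> R[i] by rewrite pnatr_eq0 -lt0n (ord_gt0 t).
by apply: (scalerI p0); rewrite -!fftK eq_ab.
Qed.

End FourierTransform.

(** * Formal conjugation, monomials and their coefficients *)

Section HermitianForms.
Local Open Scope ring_scope.
Variables (R : realType) (n p : nat).
Notation poly := (tpoly R n p).
Notation polyC := (@mpolyC #|{: tvars n p}| R[i]).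

(** Bundling the coefficient map as a ring morphism makes the general lemmas on [mmap] available for
    [fconj]. *)
Let conjC_mpoly : {rmorphism R[i] -> poly} := polyC \o Num.conj.

Lemma fconjE (f : poly) :
  fconj f = mmap conjC_mpoly
    (fun j : 'I_#|{: tvars n p}| => tvar R (conj_var (enum_val j))) f.
Proof. by []. Qed.

Lemma fconj_sum (I : finType) (f : I -> poly) :
  fconj (\sum_i f i) = \sum_i fconj (f i).
Proof. by rewrite fconjE raddf_sum. Qed.

Lemma fconjZ c (f : poly) : fconj (c *: f) = c^* *: fconj f.
Proof. by rewrite fconjE mmapZ /= mul_mpolyC. Qed.

Lemma fconj_tvar v : fconj (tvar R v : poly) = tvar R (conj_var v).
Proof. by rewrite fconjE mmapX mmap1U enum_rankK. Qed.

Lemma fft_J (X : tvec R n p) i l : fft (J X) i l = fconj (fft X i l).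
Proof.
rewrite !fftE fconj_sum (reindex_inj (inv_inj (@modoppK p))).
by apply: eq_bigr => s _; rewrite mxE modoppK fconjZ twiddle_modopp.
Qed.

Lemma fft_map_mpolyC (a : 'rV[R[i]^o]_p) l :
  fft (map_mx polyC a) 0 l = polyC (fft a 0 l).
Proof.
rewrite !fftE raddf_sum; apply: eq_bigr => s _.
by rewrite mxE -mul_mpolyC -rmorphM.
Qed.

Definition slice_vars k (l : 'I_p) (u v : k.-tuple 'I_n) : seq (tvars n p) :=
  [seq (i, l, true) | i <- u] ++ [seq (i, l, false) | i <- v].

Definition vars_mnm (s : seq (tvars n p)) : multinom #|{: tvars n p}| :=
  \big[mnm_add/mnm0]_(v <- s) mnm1 (enum_rank v).

Lemma prod_tvar (s : seq (tvars n p)) :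
  \prod_(v <- s) tvar R v = mpolyX R[i] (vars_mnm s).
Proof. by rewrite mprodXE. Qed.

Lemma vars_mnmE s v : vars_mnm s (enum_rank v) = count_mem v s.
Proof.
rewrite mnm_sumE -sum1_count [RHS]big_mkcond; apply: eq_bigr => w _.
by rewrite mnm1E (inj_eq enum_rank_inj) /=; case: eqP.
Qed.

Lemma vars_mnm_eq s t : (vars_mnm s == vars_mnm t) = perm_eq s t.
Proof.
apply/eqP/idP => [eq_st | /seq.permP eq_st].
  by apply/allP => v _; rewrite /= -!vars_mnmE eq_st.
by apply/mnmP => j; rewrite -(enum_valK j) !vars_mnmE eq_st.
Qed.

Lemma count_slice_vars k l (u v : k.-tuple 'I_n) i b :
  count_mem (i, l, b) (slice_vars k l u v) =
  if b then count_mem i u else count_mem i v.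
Proof.
rewrite count_cat !count_map.
have eq_count c (w : seq 'I_n) :
    count (preim (fun j => (j, l, c)) (pred1 (i, l, b))) w =
    if c == b then count_mem i w else 0%N.
  case: eqP => [->|cb].
    by apply: eq_count => j /=; rewrite !xpair_eqE !eqxx !andbT.
  rewrite (eq_count (a2 := pred0)) ?count_pred0 // => j /=.
  by rewrite !xpair_eqE (introF eqP cb) andbF.
by rewrite !eq_count; clear eq_count; case: b; rewrite ?addn0.
Qed.

(** The boolean tag separates conjugated variables from plain ones, so each half has its
    multiplicities counted independently. *)
Lemma perm_slice_vars k l (u v u' v' : k.-tuple 'I_n) :
  perm_eq (slice_vars k l u v) (slice_vars k l u' v') ->
  perm_eq u u' /\ perm_eq v v'.
Proof.
move/seq.permP => eq_c; split; apply/allP => i _ /=.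
  by have := eq_c (pred1 (i, l, true)); rewrite !count_slice_vars => ->.
by have := eq_c (pred1 (i, l, false)); rewrite !count_slice_vars => ->.
Qed.

Lemma perm_eq_perm_index k (u v : k.-tuple 'I_n) :
  perm_eq u v -> exists s, u = perm_index s v.
Proof. by case/tuple_permP => s eq_u; exists s; apply: val_inj. Qed.

(** The defining symmetry swaps the two halves and conjugates; a second use, with identity
    permutations, undoes both and leaves only the rearrangements. *)
Lemma conj_partially_sym_perm k (B : hypermx R n (k + k)) (u v : k.-tuple 'I_n)
    (s t : 'S_k) :
  conj_partially_sym B ->
  B [tuple of perm_index s u ++ perm_index t v] = B [tuple of u ++ v].
Proof.
move=> symB; rewrite -(symB u v t s).
have h := symB (perm_index t v) (perm_index s u) 1%g 1%g.
have perm_index1 (w : k.-tuple 'I_n) : perm_index 1 w = w.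
  by apply: eq_from_tnth => m; rewrite tnth_mktuple perm1.
by rewrite !perm_index1 in h; rewrite -h conjCK.
Qed.

Definition lhalf k (i : (k + k).-tuple 'I_n) : k.-tuple 'I_n :=
  [tuple tnth i (lshift k m) | m < k].
Definition rhalf k (i : (k + k).-tuple 'I_n) : k.-tuple 'I_n :=
  [tuple tnth i (rshift k m) | m < k].

Lemma cat_halves k (i : (k + k).-tuple 'I_n) :
  i = [tuple of lhalf k i ++ rhalf k i].
Proof.
apply: eq_from_tnth => m; case: (split_ordP m) => j ->.
  by rewrite tnth_lshift tnth_mktuple.
by rewrite tnth_rshift tnth_mktuple.
Qed.

Definition slice_mnm k l (i : (k + k).-tuple 'I_n) :=
  vars_mnm (slice_vars k l (lhalf k i) (rhalf k i)).

Lemma conj_partially_sym_mnm k (B : hypermx R n (k + k)) l i j :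
  conj_partially_sym B -> slice_mnm k l i = slice_mnm k l j -> B i = B j.
Proof.
move=> symB /eqP; rewrite vars_mnm_eq => /perm_slice_vars[].
move=> /perm_eq_perm_index[s eq_l] /perm_eq_perm_index[t eq_r].
by rewrite (cat_halves k i) (cat_halves k j) eq_l eq_r conj_partially_sym_perm.
Qed.

(** The first [k] factors become conjugated variables and the last [k] plain ones, all from slice
    [l]. *)
Lemma fft_t_form k (X : tvec R n p) (A : thypermx R n p (k + k)) l :
  indeterminate X ->
  fft (t_form k X A) 0 l =
  \sum_i fft_slice A l i *: mpolyX R[i] (slice_mnm k l i).
Proof.
move=> hX; rewrite /t_form /tmulti fft_sum; apply: eq_bigr => i _.
rewrite fft_foldl_circonv fft_map_mpolyC mul_mpolyC ffunE; congr (_ *: _).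
rewrite big_map big_enum big_split_ord -prod_tvar big_cat /=.
congr (_ * _); rewrite 2!big_map [RHS]big_enum; apply: eq_big => // m _.
  by rewrite fft_row tnth_lshift tnth_nseq fft_J hX fconj_tvar.
by rewrite fft_row tnth_rshift tnth_nseq hX.
Qed.

Lemma mcoeff_fft_t_form k (X : tvec R n p) (A : thypermx R n p (k + k)) l i :
  indeterminate X -> t_conj_partially_sym A ->
  mcoeff (slice_mnm k l i) (fft (t_form k X A) 0 l) =
  fft_slice A l i *+ #|[pred j | slice_mnm k l j == slice_mnm k l i]|.
Proof.
move=> hX symA; rewrite fft_t_form // raddf_sum -sumr_const [RHS]big_mkcond.
apply: eq_bigr => j _; rewrite /= mcoeffZ mcoeffX inE.
case: eqP => [eq_ij|_]; last by rewrite mulr0.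
by rewrite mulr1; apply: conj_partially_sym_mnm (symA l) eq_ij.
Qed.

Lemma t_form_inj k (X : tvec R n p) (A B : thypermx R n p (k + k)) :
  indeterminate X -> t_conj_partially_sym A -> t_conj_partially_sym B ->
  t_form k X A = t_form k X B -> A = B.
Proof.
move=> hX symA symB eq_AB; apply/ffunP => i.
apply: (@fft_inj R p R[i]^o); apply/rowP => l.
have := mcoeff_fft_t_form k X B l i hX symB.
rewrite -eq_AB mcoeff_fft_t_form // !ffunE; set N := #|_|.
(* The class counted by [N] contains [i] itself, so this common multiplicity cancels in
   characteristic zero. *)
have N_gt0 : (0 < N)%N by apply/card_gt0P; exists i; rewrite inE.
by move/eqP; rewrite eqrMn2r eqn0Ngt N_gt0 => /eqP.
Qed.

End HermitianForms.

Local Open Scope classical_set_scope.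

Theorem fact3p18 (R : realType) (k n p : nat)
    (hk : (0 < k)%N) (hn : (0 < n)%N) (hp : (0 < p)%N)
    (X : tvec R n p) (hX : indeterminate X) :
  set_bij [set A : thypermx R n p (k + k) | t_conj_partially_sym A]
          [set h | t_Hermitian_form k X h]
          (t_form k X).
Proof.
split.
- by move=> A symA; exists A.
- by move=> A B /set_mem symA /set_mem symB; apply: t_form_inj hX symA symB.
(* Surjectivity is built into the definition of a form; the content lies in injectivity. *)
- by move=> h [A symA ->]; exists A.
Qed.
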